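(* Let $G$ be a connected $k$-regular graph with $n$ vertices and $m$ edges, where $m\ge n$. Let $G_1$ and $G_2$ be two arbitrary graphs with $n_1\ge1$ and $n_2\ge1$ vertices, respectively. Then the Laplacian spectrum of the $Q$-graph double join $G^Q\vee(G_1^\bullet,G_2^\circ)$ consists of: (i) $\lambda_i(G_1)+n$, for $i=2,3,\ldots,n_1$; (ii) $\lambda_i(G_2)+m$, for $i=2,3,\ldots,n_2$; (iii) $\dfrac{(n_1+k+n_2+2+\lambda_i(G))\pm\sqrt{(n_1+k-n_2-2-\lambda_i(G))^2+4(2k-\lambda_i(G))}}{2}$, for $i=2,3,\ldots,n$; (iv) $n_2+2k+2$, repeated $m-n$ times; (v) the four roots of the equation $$\begin{aligned}\lambda\bigl(&\lambda^3-(m+n+n_1+k+n_2+2)\lambda^2+(2m+(n_1+k+n)(m+n_2+2)+nk-2k)\lambda\\&+2(n+m)k-2(n_1+k+n)m-nk(m+n_2+2)\bigr)=0.\end{aligned}$$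
   Context: All graphs are finite and simple. The Laplacian matrix of a graph $H$ is $L(H)=D(H)-A(H)$, where $A(H)$ is the adjacency matrix and $D(H)$ the diagonal matrix of vertex degrees. The Laplacian spectrum of $H$ is the list of all eigenvalues of $L(H)$ counted with multiplicity; if $H$ has $N$ vertices they are written $\lambda_1(H)\le\lambda_2(H)\le\cdots\le\lambda_N(H)$. The $Q$-graph $Q(G)$ is obtained from $G$ by inserting a new vertex into every edge of $G$ and adding edges between those pairs of inserted vertices which lie on adjacent edges of $G$; let $I(G)$ be the set of new vertices. The $Q$-graph double join $G^Q\vee(G_1^\bullet,G_2^\circ)$ is the graph obtained from the disjoint union of $Q(G)$, $G_1$ and $G_2$ by joining every original vertex of $G$ (in $Q(G)$) to every vertex of $G_1$ and every vertex of $I(G)$ to every vertex of $G_2$. *)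

(* Defs.v *)
From mathcomp Require Import all_boot all_order all_algebra.
From mathcomp Require Import polyrcf.

Set Implicit Arguments.
Unset Strict Implicit.
Unset Printing Implicit Defensive.

Import Order.TTheory GRing.Theory Num.Theory.
Local Open Scope ring_scope.

Record sgraph := SGraph {
  svertex :> finType;
  sedge : rel svertex;
  sedge_sym : symmetric sedge;
  sedge_irrefl : irreflexive sedge
}.

Notation "x -- y" := (sedge x y) (at level 30).

Definition degree (G : sgraph) (x : G) : nat := #|[set y | x -- y]|.

Definition regular (G : sgraph) (k : nat) : Prop := forall x : G, degree x = k.

(* Connected graphs are nonempty, by the usual convention. *)
Definition connected_graph (G : sgraph) : Prop :=
  (0 < #|G|)%N /\ forall x y : G, connect (@sedge G) x y.

Definition edges (G : sgraph) : {set {set G}} :=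
  [set e | [exists x, exists y, (x -- y) && (e == [set x; y])]].

Definition edge_type (G : sgraph) : finType := {e : {set G} | e \in edges G}.

Section QGraph.
Variable G : sgraph.

(* [inl v] is the original vertex v, [inr e] the vertex inserted into e;
   original vertices are pairwise nonadjacent, the edges being subdivided. *)
Definition qgraph_rel (a b : G + edge_type G) : bool :=
  match a, b with
  | inl _, inl _ => false
  | inl v, inr e => v \in val e
  | inr e, inl v => v \in val e
  | inr e, inr f => (e != f) && (val e :&: val f != set0)
  end.

Lemma qgraph_sym : symmetric qgraph_rel.
Proof. by move=> [v|e] [w|f] //=; rewrite eq_sym setIC. Qed.

Lemma qgraph_irrefl : irreflexive qgraph_rel.
Proof. by move=> [v|e] //=; rewrite eqxx. Qed.

Definition qgraph : sgraph := SGraph qgraph_sym qgraph_irrefl.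

End QGraph.

Section QGraphDoubleJoin.
Variables G G1 G2 : sgraph.

Definition qdjoin_rel (a b : qgraph G + (G1 + G2)) : bool :=
  match a, b with
  | inl x, inl y => x -- y
  | inr (inl x), inr (inl y) => x -- y
  | inr (inr x), inr (inr y) => x -- y
  | inl (inl _), inr (inl _) | inr (inl _), inl (inl _) => true
  | inl (inr _), inr (inr _) | inr (inr _), inl (inr _) => true
  | _, _ => false
  end.

Lemma qdjoin_sym : symmetric qdjoin_rel.
Proof.
move=> [[v|e]|[x|x]] [[w|f]|[y|y]] //;
  first [exact: qgraph_sym | exact: sedge_sym].
Qed.

Lemma qdjoin_irrefl : irreflexive qdjoin_rel.
Proof.
by move=> [[v|e]|[x|x]]; first [exact: qgraph_irrefl | exact: sedge_irrefl].
Qed.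

Definition qdjoin : sgraph := SGraph qdjoin_sym qdjoin_irrefl.

End QGraphDoubleJoin.

Section Spectrum.
Variable R : rcfType.

(* The roots in R of a polynomial, in increasing order and repeated
   according to multiplicity. *)
Definition roots_mult (p : {poly R}) : seq R :=
  flatten [seq nseq (mup x p) x | x <- rootsR p].

Definition adjacency_mx (H : sgraph) : 'M[R]_#|H| :=
  \matrix_(i, j) (enum_val i -- enum_val j)%:R.

Definition degree_mx (H : sgraph) : 'M[R]_#|H| :=
  diag_mx (\row_i (degree (enum_val i))%:R).

Definition laplacian (H : sgraph) : 'M[R]_#|H| := degree_mx H - adjacency_mx H.

(* The Laplacian is real symmetric, so it has #|H| eigenvalues in R. *)
Definition lap_spectrum (H : sgraph) : seq R :=
  roots_mult (char_poly (laplacian H)).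

(* The i-th smallest Laplacian eigenvalue, for 1 <= i <= #|H|. *)
Definition lap_eig (H : sgraph) (i : nat) : R := nth 0 (lap_spectrum H) i.-1.

End Spectrum.

(* Main.v *)
(** Let [B] be the vertex-edge incidence matrix of [G].  As [G] is [k]-regular,
    [B B^T = 2k - L(G)] and the line graph of [G] has adjacency matrix [B^T B - 2],
    so the Laplacian of the double join is a block matrix in [L(G1)], [L(G2)], [B]
    and all-ones blocks.  Its characteristic polynomial is evaluated at a generic
    [x]: since the rows of every block have constant sums, the blocks of [G1], [G2]
    and then the one of the edges are eliminated by explicit Schur complements,
    leaving a determinant of the form [det (p - q L(G) - t J)] with [J] the all-ones
    matrix, in which [J] only affects the factor of the trivial eigenvalue [0] of
    [L(G)].  The quartic collects the factors of the trivial eigenvalues; it splits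
    because it divides a characteristic polynomial of a real symmetric matrix. *)
Require Import Defs.
From mathcomp Require Import all_boot all_order all_fingroup all_algebra.
From mathcomp Require Import polyrcf complex zify ring lra.

Set Implicit Arguments.
Unset Strict Implicit.
Unset Printing Implicit Defensive.

Import Order.TTheory GRing.Theory Num.Theory.
Local Open Scope ring_scope.

(** * Laplacian spectra *)

Lemma count_flatten_nseq (T : eqType) (f : T -> nat) (s : seq T) x : uniq s ->
  count_mem x (flatten [seq nseq (f y) y | y <- s]) = ((x \in s) * f x)%N.
Proof.
elim: s => //= y s IHs /andP[ys us]; rewrite count_cat count_nseq IHs // in_cons.
rewrite /= [x == y]eq_sym; case: eqVneq => [<-|_] //=.
by rewrite (negPf ys) mul0n addn0.
Qed.

Lemma char_poly_conj (A : comNzRingType) n (P Q M : 'M[A]_n) :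
  P *m Q = 1%:M -> char_poly (P *m M *m Q) = char_poly M.
Proof.
move=> PQ; rewrite /char_poly /char_poly_mx !map_mxM /=.
have PQX : map_mx polyC P *m map_mx polyC Q = 1%:M by rewrite -map_mxM PQ map_mx1.
have {1}-> : 'X%:M = map_mx polyC P *m 'X%:M *m map_mx polyC Q.
  by rewrite scalar_mxC -mulmxA PQX mulmx1.
by rewrite -mulmxBl -mulmxBr !det_mulmx mulrAC -det_mulmx PQX det1 mul1r.
Qed.

Section RootsMult.
Variable R : rcfType.

(** This turns every spectrum computation into a factorisation of the characteristic polynomial: the
    multiplicity of a root of a product of linear factors is its number of occurrences in the
    list. *)
Lemma perm_roots_mult (s : seq R) :
  perm_eq (roots_mult (\prod_(x <- s) ('X - x%:P))) s.
Proof.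
set p := \prod_(x <- s) _.
have p_neq0 : p != 0 by rewrite monic_neq0 ?monic_prod_XsubC.
apply/allP => x _ /=; rewrite count_flatten_nseq; last first.
  by apply: sorted_uniq (sorted_roots _ _ _); [exact: lt_trans | exact: ltxx].
rewrite -(roots_on_rootsR p_neq0) in_itv /= root_prod_XsubC mu_prod_XsubC.
by apply/eqP; have [|/count_memPn ->] := boolP (x \in s); rewrite ?mul1n.
Qed.

Lemma sorted_roots_mult (p : {poly R}) : sorted <=%R (roots_mult p).
Proof.
rewrite /roots_mult; have : sorted <%R (rootsR p) by exact: sorted_roots.
elim: (rootsR p) => //= x s IHs xs.
rewrite (sorted_pairwise le_trans) pairwise_cat -!(sorted_pairwise le_trans).
rewrite IHs ?(path_sorted xs) // andbT; apply/andP; split.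
  apply/allrelP => y z /nseqP[-> _] /flattenP[_ /mapP[w ws ->] /nseqP[-> _]].
  by apply/ltW/(allP (order_path_min lt_trans xs)).
by elim: (mup x p) => //= -[|j] //= ->; rewrite lexx.
Qed.

(** Over [R[i]] the matrix becomes Hermitian, so the spectral theorem diagonalises it with real
    diagonal entries. The resulting factorisation descends to [R] because the embedding of
    polynomials is injective. *)
Lemma symmetric_char_poly_split n (A : 'M[R]_n) : A^T = A ->
  exists s : seq R, char_poly A = \prod_(x <- s) ('X - x%:P).
Proof.
move=> Asym; pose f := real_complex R; pose AC := map_mx f A.
have AC_herm : AC \is hermsymmx.
  apply: realsym_hermsym.
    apply/is_hermitianmxP; rewrite expr0 scale1r.
    by apply/matrixP => i j; rewrite !mxE -{1}Asym mxE.
  by apply/mxOverP => i j; rewrite mxE; apply/complex_realP; exists (A i j).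
have /orthomx_spectralP AC_eq := hermitian_normalmx AC_herm.
have /mxOverP D_real := hermitian_spectral_diag_real AC_herm.
set D := spectral_diag AC in AC_eq D_real.
exists [seq complex.Re (D 0 i) | i <- enum 'I_n].
apply: (map_poly_inj f); rewrite map_char_poly -/AC AC_eq.
rewrite char_poly_conj ?mulVmx ?spectral_unit // char_poly_trig ?diag_mx_is_trig //.
rewrite rmorph_prod big_map big_enum /=; apply: eq_bigr => i _.
rewrite rmorphB /= map_polyX map_polyC /= mxE eqxx mulr1n.
by have /complex_realP[k ->] := D_real 0 i.
Qed.

Lemma sum_enum_val (V : nmodType) (T : finType) (F : T -> V) :
  \sum_(i < #|T|) F (enum_val i) = \sum_x F x.
Proof. by rewrite [RHS](reindex _ (onW_bij _ (enum_val_bij T))). Qed.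

Lemma sum_mem (S : pzSemiRingType) (T : finType) (A : {set T}) :
  \sum_x (x \in A)%:R = #|A|%:R :> S.
Proof.
by rewrite -sum1_card natr_sum [RHS]big_mkcond; apply: eq_bigr => x _; case: (x \in A).
Qed.

Section Laplacian.
Variable H : sgraph.

Lemma degreeE (x : H) : (degree x)%:R = \sum_y (x -- y)%:R :> R.
Proof. by rewrite /degree -sum_mem; apply: eq_bigr => y _; rewrite inE. Qed.

Lemma laplacianE i j : laplacian R H i j =
  (degree (enum_val i))%:R *+ (i == j) - (enum_val i -- enum_val j)%:R.
Proof. by rewrite !mxE. Qed.

Lemma laplacian_sym : (laplacian R H)^T = laplacian R H.
Proof.
apply/matrixP => i j; rewrite mxE !laplacianE sedge_sym [j == i]eq_sym.
by case: eqP => // ->.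
Qed.

Lemma laplacian_const : laplacian R H *m (const_mx 1 : 'cV_#|H|) = 0.
Proof.
apply/colP => i; rewrite [RHS]mxE mulmxBl mxE [X in _ + X]mxE.
rewrite mul_diag_mx !mxE degreeE mulr1.
under [X in _ - X]eq_bigr do rewrite !mxE mulr1.
by rewrite (sum_enum_val (fun y => (enum_val i -- y)%:R)) subrr.
Qed.

Lemma char_poly_laplacian :
  char_poly (laplacian R H) = \prod_(x <- lap_spectrum R H) ('X - x%:P).
Proof.
have [s Ds] := symmetric_char_poly_split laplacian_sym.
by rewrite /lap_spectrum Ds; apply/esym/perm_big/perm_roots_mult.
Qed.

Lemma mem_lap_spectrum x : (x \in lap_spectrum R H) = eigenvalue (laplacian R H) x.
Proof.
by rewrite eigenvalue_root_char char_poly_laplacian root_prod_XsubC.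
Qed.

Lemma size_lap_spectrum : size (lap_spectrum R H) = #|H|.
Proof.
by have := size_char_poly (laplacian R H);
  rewrite char_poly_laplacian size_prod_XsubC => -[].
Qed.

(* Gershgorin: [y] is a vertex where an eigenvector has largest modulus. *)
Lemma lap_spectrum_bound x : x \in lap_spectrum R H ->
  exists y : H, `|x - (degree y)%:R| <= (degree y)%:R.
Proof.
rewrite mem_lap_spectrum => /eigenvalueP[v /rowP vL /rV0Pn[j0 vj0]].
have [j _ vmax] := @arg_maxP _ _ _ j0 xpredT (fun j => `|v 0 j|) isT.
exists (enum_val j); set d := _%:R.
have vj_gt0 : 0 < `|v 0 j|.
  by apply: lt_le_trans (vmax j0 isT); rewrite normr_gt0.
rewrite -(ler_pM2r vj_gt0) -normrM mulrBl.
have -> : x * v 0 j = d * v 0 j - \sum_i v 0 i * (enum_val i -- enum_val j)%:R.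
  move: (vL j); rewrite !mxE => <-.
  under eq_bigr do rewrite laplacianE mulrBr.
  rewrite sumrB; congr (_ - _).
  rewrite (bigD1 j) //= eqxx mulrC big1 ?addr0 // => i /negPf->.
  by rewrite mulr0.
rewrite addrAC subrr add0r normrN (le_trans (ler_norm_sum _ _ _)) //.
rewrite /d degreeE -(sum_enum_val (fun y => (enum_val j -- y)%:R)) mulr_suml.
apply: ler_sum => i _; rewrite normrM mulrC normr_nat [enum_val i -- _]sedge_sym.
by rewrite ler_wpM2l ?ler0n //; exact: vmax.
Qed.

Lemma lap_spectrum_ge0 x : x \in lap_spectrum R H -> 0 <= x.
Proof. by move=> /lap_spectrum_bound[y]; rewrite ler_norml; lra. Qed.

(** This bound keeps the term [2 * k%:R - x] of the discriminant in (iii) nonnegative. *)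
Lemma lap_spectrum_regular k x :
  regular H k -> x \in lap_spectrum R H -> x <= 2 * k%:R.
Proof. by move=> rH /lap_spectrum_bound[y]; rewrite rH ler_norml; lra. Qed.

(** The all-ones vector gives the eigenvalue 0, and it comes first because the list is sorted and
    has no negative entry. Indices start at 2 because [lap_eig] counts from 1. *)
Lemma lap_spectrum_cons : (0 < #|H|)%N ->
  lap_spectrum R H = 0 :: [seq lap_eig R H i | i <- index_iota 2 #|H|.+1].
Proof.
move=> H_gt0; rewrite /lap_eig; set s := lap_spectrum R H.
have s0 : 0 \in s.
  rewrite mem_lap_spectrum; apply/eigenvalueP; exists (const_mx 1).
    (* [eigenvalue] speaks of row vectors, so the relation for the all-ones column is transposed. *)
    by rewrite scale0r -[RHS]trmx0 -laplacian_const trmx_mul laplacian_sym trmx_const.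
  by apply/rV0Pn; exists (Ordinal H_gt0); rewrite mxE oner_neq0.
have s_sorted : sorted <=%R s := sorted_roots_mult _.
have s_ge0 := lap_spectrum_ge0; rewrite -/s in s_ge0.
have := size_lap_spectrum; rewrite -/s => <-.
case: s s0 s_sorted s_ge0 => //= x s s0 xs s_ge0; congr cons.
  apply/le_anti; rewrite s_ge0 ?mem_head //.
  move: s0; rewrite in_cons => /predU1P[->|]; first by rewrite lexx.
  by move/(allP (order_path_min le_trans xs)) => ->.
apply: (@eq_from_nth _ 0) => [|i lt_i]; first by rewrite size_map size_iota /=; lia.
have lt_i2 : (i < (size s).+2 - 2)%N by rewrite subSS subn1.
by rewrite (nth_map 0%N) ?size_iota //= nth_iota.
Qed.
End Laplacian.
End RootsMult.

(** * Determinants of matrices with constant blocks *)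

Section Det.
Variable R : comUnitRingType.

(** Subtracting the second block column times [Z] from the first clears the lower left block. An
    explicit solution [Z] of [C *m Z = Y] stands in for the inverse of [C] applied to [Y]. *)
Lemma det_block_schur n1 n2 (X : 'M[R]_n1) B Y (C : 'M_n2) (Z : 'M_(n2, n1)) :
  C *m Z = Y -> \det (block_mx X B Y C) = \det (X - B *m Z) * \det C.
Proof.
move=> <-.
have <- : \det (block_mx 1%:M 0 (- Z) (1%:M : 'M_n2)) * \det (block_mx X B (C *m Z) C)
        = \det (block_mx X B (C *m Z) C) by rewrite det_lblock !det1 !mul1r.
rewrite mulrC -det_mulmx mulmx_block !mulmx1 !mulmx0 !mulmxN.
by rewrite subrr !add0r det_ublock.
Qed.

Lemma det_block_addrow n1 n2 (X : 'M[R]_n1) B Y (C : 'M_n2) (W : 'M_(n2, n1)) :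
  \det (block_mx X B Y C) = \det (block_mx X B (Y + W *m X) (C + W *m B)).
Proof.
have <- : \det (block_mx 1%:M 0 W (1%:M : 'M_n2)) * \det (block_mx X B Y C)
        = \det (block_mx X B Y C) by rewrite det_lblock !det1 !mul1r.
rewrite -det_mulmx mulmx_block !mul1mx !mul0mx !addr0.
by rewrite ![W *m _ + _]addrC.
Qed.

Lemma mul_const_mx1 n1 n2 n3 :
  (const_mx 1 : 'M[R]_(n1, n2)) *m (const_mx 1 : 'M_(n2, n3)) = const_mx n2%:R.
Proof.
apply/matrixP => i j; rewrite !mxE (eq_bigr (fun=> 1)) ?sumr_const ?card_ord //.
by move=> l _; rewrite !mxE mulr1.
Qed.

Lemma const_mxE m n (a : R) : const_mx a = a *: const_mx 1 :> 'M_(m, n).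
Proof. by apply/matrixP => i j; rewrite !mxE mulr1. Qed.

Lemma mul_mx_const1 m n p (A : 'M[R]_(m, n)) a :
  A *m (const_mx 1 : 'cV_n) = const_mx a ->
  A *m (const_mx 1 : 'M_(n, p)) = const_mx a.
Proof.
move=> Aa; apply/matrixP => i j; move/colP/(_ i): Aa; rewrite !mxE => <-.
by apply: eq_bigr => l _; rewrite !mxE.
Qed.

(** The all-ones matrix is a column times a row; the determinant of the matrix bordered by these two
    vectors is computed by eliminating either diagonal block. *)
Lemma det_1Dconst n (s : R) :
  \det (1%:M + s *: const_mx 1 : 'M_n) = 1 + s * n%:R.
Proof.
pose u : 'cV[R]_n := const_mx 1; pose w : 'rV[R]_n := s *: const_mx 1.
have -> : s *: const_mx 1 = - (u *m - w).
  by rewrite mulmxN opprK -scalemxAr mul_const_mx1.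
have -> : \det (1%:M - u *m - w) = \det (block_mx 1%:M u (- w) (1%:M : 'M_1)).
  by rewrite (@det_block_schur _ _ _ _ _ _ (- w)) ?mul1mx // det1 mulr1.
rewrite (det_block_addrow _ _ _ _ w) mulmx1 addNr det_ublock det1 mul1r.
rewrite /w -scalemxAl mul_const_mx1.
by rewrite [_ + _]mx11_scalar det_scalar1 !mxE eqxx.
Qed.

Lemma horner_char_poly n (A : 'M[R]_n) x : (char_poly A).[x] = \det (x%:M - A).
Proof.
rewrite -horner_evalE -det_map_mx; congr (\det _); apply/matrixP => i j.
by rewrite !mxE rmorphB rmorphMn /= !horner_evalE hornerC hornerX.
Qed.

End Det.

Section DetField.
Variable F : fieldType.

(** With J the all-ones matrix, [A *m J = c *: J], so [A] factors out on the left and leaves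
    [1 + (t / c) J]. *)
Lemma det_add_const n (A : 'M[F]_n) c t :
  A *m (const_mx 1 : 'cV_n) = const_mx c -> c != 0 ->
  \det (A + t *: const_mx 1) = (1 + t / c * n%:R) * \det A.
Proof.
move=> Ac c0; rewrite mulrC -det_1Dconst -det_mulmx mulmxDr mulmx1 -scalemxAr.
by rewrite (mul_mx_const1 _ Ac) (const_mxE _ _ c) scalerA divfK.
Qed.

Lemma det_scalar_const n (b t : F) : b != 0 ->
  \det (b%:M + t *: const_mx 1 : 'M_n) = (1 + t / b * n%:R) * b ^+ n.
Proof.
move=> b0; rewrite (@det_add_const _ _ b) ?det_scalar //.
by rewrite mul_scalar_mx -const_mxE.
Qed.

Lemma det_sub_scale n (A : 'M[F]_n) p q : q != 0 ->
  \det (p%:M - q *: A) = q ^+ n * (char_poly A).[p / q].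
Proof.
move=> q0; rewrite horner_char_poly -detZ scalerBr scale_scalar_mx.
by rewrite mulrC divfK.
Qed.

(** * Schur elimination of the four-block matrix at a generic point *)

Section DoubleJoin.
Variables (n m n1 n2 : nat) (k : F).
Variables (L : 'M[F]_n) (L1 : 'M[F]_n1) (L2 : 'M[F]_n2) (B : 'M[F]_(n, m)).
Hypothesis L_const : L *m (const_mx 1 : 'cV_n) = 0.
Hypothesis L1_const : L1 *m (const_mx 1 : 'cV_n1) = 0.
Hypothesis L2_const : L2 *m (const_mx 1 : 'cV_n2) = 0.
Hypothesis B_const : B *m (const_mx 1 : 'cV_m) = const_mx k.
Hypothesis BT_const : B^T *m (const_mx 1 : 'cV_n) = const_mx 2.
Hypothesis BBT : B *m B^T = (2 * k)%:M - L.

(** The blocks are ordered as vertices of [G], inserted vertices, [G1], [G2]. An inserted vertex has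
    degree [n2 + 2k], and subtracting the line graph adjacency [B^T B - 2] gives
    [n2 + 2k + 2 - B^T B]. *)
Definition dj_mx : 'M[F]_((n + m) + (n1 + n2)) :=
  block_mx (block_mx (k + n1%:R)%:M (- B) (- B^T)
                     ((n2%:R + 2 * k + 2)%:M - B^T *m B))
           (block_mx (const_mx (-1)) 0 0 (const_mx (-1)))
           (block_mx (const_mx (-1)) 0 0 (const_mx (-1)))
           (block_mx (n%:R%:M + L1) 0 0 (m%:R%:M + L2)).

(** Eliminating [G1] and [G2] subtracts [al J] and [be J] from the vertex and edge blocks.
    Eliminating the edges then leaves [b^-1 (p - q L - t J)], where [zt] is the weight of J in the
    solution of the edge system. The nonvanishing hypotheses are on the quantities divided by. *)
Lemma det_double_join x (a := x - k - n1%:R) (b := x - n2%:R - 2 * k - 2)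
  (al := n1%:R / (x - n%:R)) (be := n2%:R / (x - m%:R))
  (p := a * b - (1 - a) * (2 * k)) (q := a - 1)
  (zt := (2 * al * b + be * (1 - a) * k) / (b - m%:R * be))
  (t := al * b + zt * k) :
  x - n%:R != 0 -> x - m%:R != 0 -> b != 0 -> b - m%:R * be != 0 ->
  p != 0 -> q != 0 ->
  (char_poly dj_mx).[x] =
    (char_poly L1).[x - n%:R] * (char_poly L2).[x - m%:R]
    * ((1 - be / b * m%:R) * b ^+ m)
    * (b^-1 ^+ n * ((1 - t / p * n%:R) * (q ^+ n * (char_poly L).[p / q]))).
Proof.
move=> xn xm b0 bm p0 q0; rewrite horner_char_poly /dj_mx.
rewrite !(scalar_mx_block, opp_block_mx, add_block_mx, oppr0, addr0, add0r, opprK).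
pose J r s : 'M[F]_(r, s) := const_mx 1.
have JJ r s u : J r s *m J s u = s%:R *: J r u by rewrite /J mul_const_mx1; exact: const_mxE.
have oppJ r s : - const_mx (-1) = J r s by apply/matrixP => i j; rewrite !mxE opprK.
have mulJ r s u (A : 'M[F]_(r, s)) c : A *m (const_mx 1 : 'cV_s) = const_mx c ->
    A *m J s u = c *: J r u.
  move=> Ac; rewrite /J (mul_mx_const1 _ Ac). exact: const_mxE.
have L1J : L1 *m J n1 n = 0 by rewrite (mulJ _ _ _ _ 0) ?const_mx0 ?scale0r.
have L2J : L2 *m J n2 m = 0 by rewrite (mulJ _ _ _ _ 0) ?const_mx0 ?scale0r.
rewrite !oppJ.
have -> : x%:M - (n%:R%:M + L1) = (x - n%:R)%:M - L1 by rewrite opprD addrA raddfB.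
have -> : x%:M - (m%:R%:M + L2) = (x - m%:R)%:M - L2 by rewrite opprD addrA raddfB.
have -> : x%:M - (k + n1%:R)%:M = a%:M :> 'M_n by rewrite -raddfB opprD addrA.
have -> : x%:M - ((n2%:R + 2 * k + 2)%:M - B^T *m B) = b%:M + B^T *m B.
  by rewrite opprD opprK addrA -raddfB; congr (_%:M + _); rewrite /b; ring.
(* Since [L1] and [L2] annihilate all-ones blocks, the two diagonal blocks act on them as the
   scalars [x - n] and [x - m]. *)
pose Z := block_mx ((x - n%:R)^-1 *: J n1 n) 0 0 ((x - m%:R)^-1 *: J n2 m).
rewrite (@det_block_schur _ _ _ _ _ _ _ Z); last first.
  rewrite mulmx_block !mulmx0 !mul0mx !addr0 !add0r -!scalemxAr !mulmxBl.
  rewrite L1J L2J !subr0 !mul_scalar_mx !scalerA mulVf; last by [].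
  by rewrite mulVf ?scale1r.
rewrite det_ublock mulmx_block !mulmx0 !mul0mx !addr0 !add0r -!scalemxAr !JJ.
rewrite opp_block_mx add_block_mx !oppr0 !addr0 !scalerA.
rewrite [_^-1 * n1%:R]mulrC [_^-1 * n2%:R]mulrC -/al -/be -!horner_char_poly.
set c1 := (char_poly L1).[_]; set c2 := (char_poly L2).[_].
rewrite [LHS]mulrC -[RHS]mulrA; congr (_ * _).
have JBT r : J r m *m B^T = k *: J r n.
  have /(congr1 trmx) := mulJ _ _ r B k B_const.
  by rewrite trmx_mul linearZ /= !trmx_const.
have BTJ := mulJ _ _ _ _ _ BT_const; have BJ := mulJ _ _ _ _ _ B_const.
(* This row operation cancels [B^T *m B] in the edge block, which becomes a scalar plus a multiple
   of J and is then easy to invert. *)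
rewrite (det_block_addrow _ _ _ _ (- B^T)).
have -> : b%:M + B^T *m B - be *: J m m + - B^T *m B = b%:M + (- be) *: J m m.
  by rewrite mulNmx; apply/matrixP => i j; move: (B^T *m B) => P; rewrite !mxE; ring.
have -> : B^T + - B^T *m (a%:M - al *: J n n) = (1 - a) *: B^T + (2 * al) *: J m n.
  rewrite mulNmx mulmxBr mul_mx_scalar -scalemxAr BTJ.
  by apply/matrixP => i j; rewrite !mxE; ring.
(* The solution is sought in the span of [B^T] and J; comparing the coefficients of J fixes [zt]. *)
pose Y := b^-1 *: ((1 - a) *: B^T + zt *: J m n).
rewrite (@det_block_schur _ _ _ _ _ _ _ Y); last first.
  rewrite mulmxDl mul_scalar_mx /Y -!(scalemxAl, scalemxAr) mulmxDr.
  rewrite -!(scalemxAl, scalemxAr) JBT JJ.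
  by apply/matrixP => i j; rewrite !mxE /zt; field; rewrite bm b0.
rewrite {2}/J det_scalar_const // !mulNr mulrC; congr (_ * _).
have -> : a%:M - al *: J n n - B *m Y = b^-1 *: (p%:M - q *: L + (- t) *: J n n).
  rewrite /Y -scalemxAr mulmxDr -!scalemxAr BJ BBT.
  apply/matrixP => i j; rewrite !mxE /t /p /q.
  by case: (i == j); rewrite ?mulr1n ?mulr0n; field.
rewrite detZ /J (@det_add_const _ _ p) //; last first.
  rewrite mulmxBl mul_scalar_mx -scalemxAl L_const scaler0 subr0.
  by rewrite -const_mxE.
by rewrite det_sub_scale // !mulNr.
Qed.
End DoubleJoin.
End DetField.

(** * Incidence matrix and the Laplacian of the double join *)

Section Reindex.
Variable R : fieldType.

(** Two enumerations of [T] differ by a permutation, so the matrices are conjugate. This allows the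
    vertices of the double join to be listed block by block. *)
Lemma char_poly_reindex (T : finType) (F : T -> T -> R) N N'
    (g : 'I_N -> T) (h : 'I_N' -> T) : bijective g -> bijective h ->
  char_poly (\matrix_(i, j) F (g i) (g j)) = char_poly (\matrix_(i, j) F (h i) (h j)).
Proof.
move=> g_bij h_bij; have eqN : N = N'.
  by rewrite -(card_ord N) -(card_ord N') (bij_eq_card g_bij) (bij_eq_card h_bij).
case: _ / eqN h h_bij => h h_bij; case: g_bij => g' gK g'K.
have s_inj : injective (g' \o h) by exact: inj_comp (can_inj g'K) (bij_inj h_bij).
pose s := perm s_inj; set A := \matrix_(i, j) _; set B := \matrix_(i, j) _.
have -> : B = perm_mx s *m A *m perm_mx s^-1%g.
  by rewrite -row_permE -col_permE; apply/matrixP => i j; rewrite !mxE !permE /= !g'K.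
by rewrite char_poly_conj // -perm_mxM mulgV perm_mx1.
Qed.

(** The enumeration of a disjoint union whose splitting matches that of [block_mx]. *)
Definition sum_ord (S T : Type) a b (f : 'I_a -> S) (g : 'I_b -> T)
    (i : 'I_(a + b)) : S + T :=
  match split i with inl u => inl (f u) | inr v => inr (g v) end.

Lemma sum_ord_bij (S T : Type) a b (f : 'I_a -> S) (g : 'I_b -> T) :
  bijective f -> bijective g -> bijective (sum_ord f g).
Proof.
move=> [f' fK f'K] [g' gK g'K].
exists (fun s => unsplit (match s with inl u => inl (f' u) | inr v => inr (g' v) end)).
  move=> x; rewrite /sum_ord -{2}[x]splitK.
  by case: (split x) => u; rewrite ?fK ?gK.
by case=> u; rewrite /sum_ord unsplitK ?f'K ?g'K.
Qed.

Lemma matrix_sum_ord (S T S' T' : Type) a b a' b' (f : 'I_a -> S) (g : 'I_b -> T)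
    (f' : 'I_a' -> S') (g' : 'I_b' -> T') (F : S + T -> S' + T' -> R) :
  \matrix_(i, j) F (sum_ord f g i) (sum_ord f' g' j) =
  block_mx (\matrix_(i, j) F (inl (f i)) (inl (f' j)))
           (\matrix_(i, j) F (inl (f i)) (inr (g' j)))
           (\matrix_(i, j) F (inr (g i)) (inl (f' j)))
           (\matrix_(i, j) F (inr (g i)) (inr (g' j))).
Proof.
have sl c d U V (p : 'I_c -> U) (q : 'I_d -> V) i : sum_ord p q (lshift d i) = inl (p i).
  by rewrite /sum_ord -[lshift d i]/(unsplit (inl i)) unsplitK.
have sr c d U V (p : 'I_c -> U) (q : 'I_d -> V) i : sum_ord p q (rshift c i) = inr (q i).
  by rewrite /sum_ord -[rshift c i]/(unsplit (inr i)) unsplitK.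
by rewrite -[LHS]submxK; congr block_mx; apply/matrixP => i j; rewrite !mxE ?sl ?sr.
Qed.
End Reindex.

(** * Counting incidences between vertices and edges *)

Section Incidence.
Variables (R : rcfType) (G : sgraph).
Local Notation E := (edge_type G).

Lemma edges_pair (u v : G) : u != v -> ([set u; v] \in edges G) = u -- v.
Proof.
move=> uv; rewrite inE; apply/existsP/idP => [[x /existsP[y /andP[xy /eqP Dxy]]]|uv_edge].
  have: u \in [set x; y] by rewrite -Dxy set21.
  have: v \in [set x; y] by rewrite -Dxy set22.
  rewrite !inE => /orP[]/eqP vE /orP[]/eqP uE; move: uv xy; rewrite vE uE ?eqxx //.
  by rewrite sedge_sym.
by exists u; apply/existsP; exists v; rewrite uv_edge eqxx.
Qed.

Lemma card_edge (e : E) : #|val e| = 2%N.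
Proof.
have := valP e; rewrite inE => /existsP[x /existsP[y /andP[xy /eqP->]]].
by rewrite cards2; case: eqVneq xy => // ->; rewrite sedge_irrefl.
Qed.

Lemma edge_eq_pair (u v : G) (e : E) :
  u != v -> (u \in val e) && (v \in val e) = (val e == [set u; v]).
Proof.
move=> uv; rewrite eq_sym eqEcard cards2 uv card_edge leqnn andbT.
by rewrite subUset !sub1set.
Qed.

Lemma sum_edge_vertices (e : E) : \sum_(v : G) (v \in val e)%:R = 2 :> R.
Proof. by rewrite sum_mem card_edge. Qed.

(** Off-diagonal entries of [B B^T]: the only possible edge through both vertices is
    [[set u; v]]. *)
Lemma sum_common_edges (u v : G) : u != v ->
  \sum_(e : E) ((u \in val e)%:R * (v \in val e)%:R) = (u -- v)%:R :> R.
Proof.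
move=> uv; under eq_bigr do rewrite -natrM mulnb edge_eq_pair //.
rewrite -edges_pair //; have [uvE|uvE] := boolP (_ \in edges G).
  rewrite (bigD1 (Sub [set u; v] uvE)) //= eqxx big1 ?addr0 // => e.
  by rewrite -val_eqE => /negPf->.
by rewrite big1 // => e _; case: eqP => // De; rewrite -De (valP e) in uvE.
Qed.

(** Double counting: each neighbour shares one edge with [v], and each edge through [v] has exactly
    one other end. *)
Lemma sum_incident_edges (v : G) : \sum_(e : E) (v \in val e)%:R = (degree v)%:R :> R.
Proof.
rewrite degreeE (bigD1 v) //= sedge_irrefl add0r.
under [RHS]eq_bigr => u uv do rewrite -sum_common_edges 1?eq_sym //.
rewrite exchange_big; apply: eq_bigr => e _; rewrite -mulr_sumr.
have := sum_edge_vertices e; rewrite (bigD1 v) //=.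
by case: (v \in val e) => e2; rewrite ?mul0r // mul1r; apply: (addrI 1); rewrite e2.
Qed.

(** Entries of [B^T B]: two distinct edges meet in at most one vertex, so off the diagonal this is
    the line graph adjacency. *)
Lemma sum_common_vertices (e f : E) :
  \sum_(v : G) ((v \in val e)%:R * (v \in val f)%:R)
  = ((e != f) && (val e :&: val f != set0))%:R + 2 *+ (e == f) :> R.
Proof.
under eq_bigr do rewrite -natrM mulnb -in_setI.
rewrite sum_mem; have [->|ef] := eqVneq e f.
  by rewrite setIid card_edge add0r.
rewrite addr0 /= -card_gt0; congr _%:R.
have : (#|val e :&: val f| < 2)%N.
  rewrite -(card_edge e) ltn_neqAle subset_leq_card ?subsetIl // andbT.
  apply: contra ef => /eqP ec.
  have /eqP eI : val e :&: val f == val e by rewrite eqEcard subsetIl ec leqnn.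
  by rewrite -val_eqE eqEcard !card_edge -{1}eI subsetIr.
by case: #|_| => [|[]].
Qed.

Definition incidence_mx : 'M[R]_(#|G|, #|E|) :=
  \matrix_(i < #|G|, j < #|E|) (enum_val i \in val (enum_val j : E))%:R.

Variable k : nat.
Hypothesis G_regular : regular G k.

Lemma incidence_const : incidence_mx *m (const_mx 1 : 'cV_#|E|) = const_mx k%:R.
Proof.
apply/colP => i; rewrite !mxE -(G_regular (enum_val i)) -sum_incident_edges.
by rewrite -[RHS]sum_enum_val; apply: eq_bigr => j _; rewrite !mxE mulr1.
Qed.

Lemma tr_incidence_const : incidence_mx^T *m (const_mx 1 : 'cV_#|G|) = const_mx 2.
Proof.
apply/colP => i; rewrite !mxE -(sum_edge_vertices (enum_val i)).
by rewrite -[RHS]sum_enum_val; apply: eq_bigr => j _; rewrite !mxE mulr1.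
Qed.

Lemma incidence_mul_tr :
  incidence_mx *m incidence_mx^T = (2 * k%:R)%:M - laplacian R G.
Proof.
apply/matrixP => i j; rewrite !mxE G_regular.
under eq_bigr do rewrite !mxE.
rewrite (sum_enum_val (fun e : E => (enum_val i \in val e)%:R * (enum_val j \in val e)%:R)).
have [->|ij] := eqVneq i j; last first.
  by rewrite sum_common_edges ?(inj_eq enum_val_inj) // !mulr0n; ring.
rewrite sedge_irrefl -(G_regular (enum_val j)) -sum_incident_edges.
under eq_bigr do rewrite -natrM mulnb andbb. rewrite !mulr1n.
rewrite /=. ring.
Qed.

Lemma handshake : #|G|%:R * k%:R = 2 * #|E|%:R :> R.
Proof.
transitivity (\sum_(v : G) \sum_(e : E) (v \in val e)%:R : R).
  under eq_bigr do rewrite sum_incident_edges G_regular.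
  by rewrite sumr_const mulr_natl.
rewrite exchange_big /=; under eq_bigr do rewrite sum_edge_vertices.
by rewrite sumr_const mulr_natr.
Qed.

Lemma qdjoin_laplacian G1 G2 :
  char_poly (laplacian R (qdjoin G G1 G2)) =
  char_poly (dj_mx k%:R (laplacian R G1) (laplacian R G2) incidence_mx).
Proof.
pose H := qdjoin G G1 G2.
pose lap (x y : H) : R := (degree x)%:R *+ (x == y) - (x -- y)%:R.
have -> : laplacian R H = \matrix_(i, j < #|H|) lap (enum_val i) (enum_val j).
  by apply/matrixP => i j; rewrite laplacianE mxE /lap (inj_eq enum_val_inj).
pose h := sum_ord (sum_ord (@enum_val G predT) (@enum_val E predT))
                  (sum_ord (@enum_val G1 predT) (@enum_val G2 predT)).
rewrite (char_poly_reindex lap (enum_val_bij H) (_ : bijective h)); last first.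
  by do !apply: sum_ord_bij; exact: enum_val_bij.
have deg_v (v : G) : (degree (inl (inl v) : H))%:R = k%:R + #|G1|%:R :> R.
  rewrite degreeE !big_sumType /= sum_incident_edges G_regular.
  by rewrite !sumr_const !mul0rn addr0 add0r.
have deg_e (e : E) : (degree (inl (inr e) : H))%:R = 2 * k%:R + #|G2|%:R :> R.
  rewrite degreeE !big_sumType /= sum_edge_vertices.
  rewrite !sumr_const mul0rn add0r; congr (_ + _).
  (* The line graph degree is a row sum of [B^T B - 2]: exchanging the sums counts [k] edges at each
     of the two ends of [e], giving [2k - 2]. *)
  have -> : \sum_(f : E) ((e != f) && (val e :&: val f != set0))%:R
      = \sum_(f : E) (\sum_(v : G) ((v \in val e)%:R * (v \in val f)%:R)
          - 2 *+ (e == f)) :> R.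
    by apply: eq_bigr => f _; rewrite sum_common_vertices addrK.
  rewrite sumrB exchange_big /= [X in _ - X](bigD1 e) //= eqxx.
  rewrite [X in _ - (_ + X)]big1 => [|f]; last by rewrite eq_sym => /negPf->.
  under eq_bigr do rewrite -mulr_sumr sum_incident_edges G_regular.
  by rewrite -mulr_suml sum_edge_vertices mulr1n; ring.
have deg_1 (x : G1) : (degree (inr (inl x) : H))%:R = #|G|%:R + (degree x)%:R :> R.
  by rewrite !degreeE !big_sumType /= !sumr_const !mul0rn !addr0.
have deg_2 (x : G2) : (degree (inr (inr x) : H))%:R = #|E|%:R + (degree x)%:R :> R.
  by rewrite !degreeE !big_sumType /= !sumr_const !mul0rn !add0r.
rewrite /h matrix_sum_ord (matrix_sum_ord _ _ _ _ (fun x y => lap (inl x) (inl y))).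
rewrite (matrix_sum_ord _ _ _ _ (fun x y => lap (inl x) (inr y))).
rewrite (matrix_sum_ord _ _ _ _ (fun x y => lap (inr x) (inl y))).
rewrite (matrix_sum_ord _ _ _ _ (fun x y => lap (inr x) (inr y))).
congr char_poly; congr (block_mx (block_mx _ _ _ _) (block_mx _ _ _ _)
  (block_mx _ _ _ _) (block_mx _ _ _ _));
  apply/matrixP => i j; rewrite ![LHS]mxE /lap ?(deg_v, deg_e, deg_1, deg_2).
all: rewrite ?(inj_eq inr_inj) ?(inj_eq inl_inj) ?(inj_eq inr_inj)
  ?(inj_eq enum_val_inj) /= ?mulr0n ?sub0r ?subr0.
all: try by rewrite !mxE ?oppr0 // mulrnDl addrA.
(* Only the block of pairs of inserted vertices remains. *)
rewrite mxE [in RHS]mxE [X in _ = _ + X]mxE mxE.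
have -> : \sum_l incidence_mx^T i l * incidence_mx l j
    = ((i != j) && (val (enum_val i : E) :&: val (enum_val j : E) != set0))%:R
      + 2 *+ (i == j).
  under eq_bigr do rewrite !mxE.
  rewrite (sum_enum_val (fun v : G => (v \in val (enum_val i : E))%:R
                                      * (v \in val (enum_val j : E))%:R)).
  by rewrite sum_common_vertices (inj_eq enum_val_inj).
rewrite (inj_eq enum_val_inj); case: (i == j); rewrite ?mulr1n ?mulr0n; ring.
Qed.
End Incidence.

(** * The spectrum of the double join *)

(** The product [w * (p - q)] vanishes everywhere, hence at more natural numbers than its degree
    allows. This removes the genericity conditions on [x]. *)
Lemma poly_eq_generic (R : numDomainType) (w p q : {poly R}) : w != 0 ->
  (forall x, w.[x] != 0 -> p.[x] = q.[x]) -> p = q.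
Proof.
move=> w0 pq; apply/eqP; rewrite -subr_eq0; apply/idPn => pq0.
have wpq0 : w * (p - q) != 0 by rewrite mulf_neq0.
pose rs := [seq i%:R : R | i <- iota 0 (size (w * (p - q)))].
have rs_uniq : uniq rs.
  by rewrite map_inj_uniq ?iota_uniq //; apply: mulrIn; rewrite oner_eq0.
have /(max_poly_roots wpq0) : all (root (w * (p - q))) rs.
  apply/allP => x _; rewrite rootE !hornerE; have [->|/pq->] := eqVneq w.[x] 0.
    by rewrite mul0r.
  by rewrite subrr mulr0.
by move=> /(_ rs_uniq); rewrite size_map size_iota ltnn.
Qed.

Lemma monic_quadratic_neq0 (R : nzRingType) (a b : R) :
  'X^2 + a%:P * 'X + b%:P != 0.
Proof.
apply/eqP => /polyP/(_ 2%N); rewrite !coefE /= ?mulr0 ?addr0.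
by move/eqP; rewrite oner_eq0.
Qed.

Lemma quadratic_roots (R : rcfType) (x s d : R) : 0 <= d ->
  (x - (s + Num.sqrt d) / 2) * (x - (s - Num.sqrt d) / 2) = x ^+ 2 - s * x + (s ^+ 2 - d) / 4.
Proof. by move=> /sqr_sqrtr {3}<-; field. Qed.

Lemma dvdp_prod_XsubC_split (F : fieldType) (s : seq F) (p : {poly F}) :
  p \is monic -> p %| \prod_(x <- s) ('X - x%:P) ->
  exists2 r, p = \prod_(x <- r) ('X - x%:P) & size p = (size r).+1.
Proof.
move=> p_monic /dvdp_prod_XsubC[m]; rewrite eqp_monic ?monic_prod_XsubC //.
by move/eqP=> ->; exists (mask m s); rewrite ?size_prod_XsubC.
Qed.

(** * The quartic factor of the trivial eigenvalues *)

Section Quartic.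
Variables (F : numFieldType) (n m n1 n2 k : F).

Definition dj_quartic : {poly F} :=
  'X * ('X^3 - (m + n + n1 + k + n2 + 2)%:P * 'X^2
        + (2 * m + (n1 + k + n) * (m + n2 + 2) + n * k - 2 * k)%:P * 'X
        + (2 * (n + m) * k - 2 * (n1 + k + n) * m - n * k * (m + n2 + 2))%:P).

Lemma size_dj_quartic : size dj_quartic = 5%N.
Proof.
rewrite /dj_quartic; set c2 := _ + 2; set c1 := _ - 2 * k; set c0 := _ - n * k * _.
have -> : 'X^3 - c2%:P * 'X^2 + c1%:P * 'X + c0%:P = Poly [:: c0; c1; - c2; 1].
  by rewrite /= !cons_poly_def polyCN; ring.
by rewrite mulrC size_mulX ?(@PolyK _ 0) -?size_poly_eq0 ?(@PolyK _ 0) //= oner_neq0.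
Qed.

Lemma dj_quartic_monic : dj_quartic \is monic.
Proof.
by rewrite monicE /lead_coef size_dj_quartic /dj_quartic !coefE /= ?mulr0 ?addr0 ?subr0.
Qed.

(** The factors [x - n] and [x - m] come from the eigenvalue 0 of [G1] and [G2], the third from J in
    the edge block, and the last from the eigenvalue 0 of [G]. *)
Lemma horner_dj_quartic x (a := x - k - n1) (b := x - n2 - 2 * k - 2)
  (al := n1 / (x - n)) (be := n2 / (x - m))
  (p := a * b - (1 - a) * (2 * k))
  (zt := (2 * al * b + be * (1 - a) * k) / (b - m * be))
  (t := al * b + zt * k) :
  n * k = 2 * m -> x - n != 0 -> x - m != 0 -> b != 0 -> b - m * be != 0 -> p != 0 ->
  (x - n) * (x - m) * (1 - be / b * m) * ((1 - t / p * n) * p) = dj_quartic.[x].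
Proof.
move=> nk xn xm b0 bm p0.
(* Replacing [m] absorbs the handshake relation and leaves an identity of rational functions in
   independent variables. *)
have Dm : m = n * k / 2 by rewrite nk; field.
have -> : (1 - t / p * n) * p = p - t * n by field.
rewrite /dj_quartic !(hornerM, hornerD, hornerN, hornerXn, hornerX, hornerC).
have bm' : b * (x - m) - m * n2 != 0.
  have -> : b * (x - m) - m * n2 = (b - m * be) * (x - m) by rewrite /be; field.
  by rewrite mulf_neq0.
have -> : t = al * b + (2 * al * b * (x - m) + n2 * (1 - a) * k) / (b * (x - m) - m * n2) * k.
  by rewrite /t /zt /be; field; rewrite bm' xm.
rewrite /p /al /be; move: b0 bm'; rewrite /a /b Dm => b0 bm'.
have two_neq0 : 2 != 0 :> F by rewrite pnatr_eq0.
field; rewrite xn b0; apply/and4P; split=> //.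
  have -> : (x - n2 - 2 * k - 2) * (x * 2 - n * k) - n * k * n2
      = 2 * ((x - n2 - 2 * k - 2) * (x - n * k / 2) - n * k / 2 * n2) by field.
  by rewrite mulf_neq0.
have -> : x * 2 - n * k = 2 * (x - n * k / 2) by field.
by rewrite mulf_neq0 // -Dm.
Qed.
End Quartic.

Lemma horner_prod_XsubC (F : comNzRingType) (s : seq F) x :
  (\prod_(y <- s) ('X - y%:P)).[x] = \prod_(y <- s) (x - y).
Proof. by rewrite horner_prod; apply: eq_bigr => y _; rewrite !hornerE. Qed.

(** One factor [q] goes to each of the [N] linear factors; the root 0 contributes [p]. *)
Lemma prod_sub_scale (F : fieldType) (s : seq F) (p q : F) N :
  (size s).+1 = N -> q != 0 ->
  q ^+ N * ('X * \prod_(y <- s) ('X - y%:P)).[p / q]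
  = p * \prod_(y <- s) (p - q * y).
Proof.
move=> <- q0; rewrite exprS hornerM hornerX horner_prod_XsubC mulrACA mulrC.
have -> : q * (p / q) = p by field.
rewrite mulrC; congr (_ * _); elim: s => [|y s IHs]; rewrite ?big_nil ?mulr1 //=.
by rewrite !big_cons exprS mulrACA IHs; congr (_ * _); field.
Qed.

(** * Assembling the factorisation *)

Section Main.
Variables (R : rcfType) (G G1 G2 : sgraph) (k : nat).
Hypothesis G_regular : regular G k.
Hypothesis le_GE : (#|G| <= #|edge_type G|)%N.
Hypotheses (G_gt0 : (0 < #|G|)%N) (G1_gt0 : (0 < #|G1|)%N) (G2_gt0 : (0 < #|G2|)%N).
Local Notation n := (#|G|).
Local Notation m := (#|edge_type G|).
Local Notation n1 := (#|G1|).
Local Notation n2 := (#|G2|).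

Definition lap_tail (H : sgraph) : seq R := [seq lap_eig R H i | i <- index_iota 2 #|H|.+1].

Lemma char_poly_laplacian_tail (H : sgraph) : (0 < #|H|)%N ->
  char_poly (laplacian R H) = 'X * \prod_(x <- lap_tail H) ('X - x%:P).
Proof.
by move=> H_gt0; rewrite char_poly_laplacian lap_spectrum_cons // big_cons subr0.
Qed.

Definition dj_disc (y : R) : R :=
  (n1%:R + k%:R - n2%:R - 2 - y) ^+ 2 + 4 * (2 * k%:R - y).

Definition dj_root_plus (y : R) : R :=
  (n1%:R + k%:R + n2%:R + 2 + y + Num.sqrt (dj_disc y)) / 2.

Definition dj_root_minus (y : R) : R :=
  (n1%:R + k%:R + n2%:R + 2 + y - Num.sqrt (dj_disc y)) / 2.

Definition dj_eigs : seq R :=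
  [seq y + n%:R | y <- lap_tail G1] ++ [seq y + m%:R | y <- lap_tail G2]
  ++ [seq dj_root_plus y | y <- lap_tail G] ++ [seq dj_root_minus y | y <- lap_tail G]
  ++ nseq (m - n) (n2%:R + 2 * k%:R + 2).

(** The right side is [p - q y], a monic quadratic in [x] with discriminant [dj_disc y]. Regularity
    gives [y <= 2k], so the discriminant is nonnegative and [Num.sqrt] is a genuine square root. *)
Lemma dj_root_mul x y : y \in lap_tail G ->
  (x - dj_root_plus y) * (x - dj_root_minus y) =
  (x - k%:R - n1%:R) * (x - n2%:R - 2 * k%:R - 2) - (1 - (x - k%:R - n1%:R)) * (2 * k%:R)
  - (x - k%:R - n1%:R - 1) * y.
Proof.
move=> yG; rewrite quadratic_roots /dj_disc; first by field.
rewrite addr_ge0 ?sqr_ge0 // mulr_ge0 // subr_ge0 (lap_spectrum_regular G_regular) //.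
by rewrite lap_spectrum_cons // in_cons yG orbT.
Qed.

Lemma qdjoin_char_poly :
  char_poly (laplacian R (qdjoin G G1 G2)) =
  \prod_(x <- dj_eigs) ('X - x%:P) * dj_quartic n%:R m%:R n1%:R n2%:R k%:R.
Proof.
rewrite (qdjoin_laplacian _ G_regular).
pose cb : R := n2%:R + 2 * k%:R + 2.
(* The six factors evaluate to [x - n], [x - m], [b], [(b - m be)(x - m)], [p] and [q]: exactly what
   the elimination requires to be nonzero. *)
apply: (@poly_eq_generic _ (('X - n%:R%:P) * ('X - m%:R%:P) * ('X - cb%:P)
  * ('X^2 + (- cb - m%:R)%:P * 'X + (cb * m%:R - m%:R * n2%:R)%:P)
  * ('X^2 + (2 * k%:R - k%:R - n1%:R - cb)%:P * 'X
     + ((k%:R + n1%:R) * cb - 2 * k%:R * (1 + k%:R + n1%:R))%:P)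
  * ('X - (k%:R + n1%:R + 1)%:P))).
  by rewrite !mulf_neq0 ?polyXsubC_eq0 ?monic_quadratic_neq0.
move=> x w0; rewrite [RHS]hornerM.
rewrite !(hornerM, hornerD, hornerN, hornerXn, hornerX, hornerC) !mulf_eq0 !negb_or in w0.
move: w0; rewrite -!andbA => /and5P[xn xm xcb bm' /andP[p0' q0']].
pose a : R := x - k%:R - n1%:R; pose b : R := x - n2%:R - 2 * k%:R - 2.
pose al : R := n1%:R / (x - n%:R); pose be : R := n2%:R / (x - m%:R).
pose p : R := a * b - (1 - a) * (2 * k%:R); pose q : R := a - 1.
pose zt : R := (2 * al * b + be * (1 - a) * k%:R) / (b - m%:R * be).
pose t : R := al * b + zt * k%:R.
have b0 : b != 0 by apply: contra xcb; rewrite /b /cb; congr (_ == 0); ring.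
have q0 : q != 0 by apply: contra q0'; rewrite /q /a; congr (_ == 0); ring.
have p0 : p != 0 by apply: contra p0'; rewrite /p /a /b /cb; congr (_ == 0); ring.
have bm : b - m%:R * be != 0.
  apply: contra bm' => /eqP bm'; apply/eqP.
  transitivity ((b - m%:R * be) * (x - m%:R)); first by rewrite /b /be /cb; field.
  by rewrite bm' mul0r.
rewrite (det_double_join (laplacian_const _ _) (laplacian_const _ _)
  (laplacian_const _ _) (incidence_const _ G_regular) (tr_incidence_const _ _)
  (incidence_mul_tr _ G_regular)) // -/a -/b -/al -/be -/p -/q -/zt -/t.
rewrite -(horner_dj_quartic (handshake _ G_regular)) // -/a -/b -/al -/be -/p -/zt -/t.
have sz_tail : (size (lap_tail G)).+1 = n.
  by rewrite -(size_lap_spectrum R G) lap_spectrum_cons.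
rewrite !char_poly_laplacian_tail // (prod_sub_scale _ sz_tail) //.
rewrite !hornerM !hornerX !horner_prod_XsubC /dj_eigs !big_cat.
have : \prod_(y <- lap_tail G) (p - q * y)
    = \prod_(y <- lap_tail G) (x - dj_root_plus y)
      * \prod_(y <- lap_tail G) (x - dj_root_minus y).
  by rewrite -big_split; apply: eq_big_seq => y yG; rewrite [RHS]dj_root_mul.
move: (lap_tail G) (lap_tail G1) (lap_tail G2) => s s1 s2 ->.
rewrite !big_map big_nseq iter_mulr_1.
(* Here [n <= m] enters: [b ^+ n] cancels [b^-1 ^+ n], and [b ^+ (m - n)] gives the repeated
   eigenvalue of (iv). *)
have -> : b ^+ m = b ^+ n * b ^+ (m - n) by rewrite -exprD subnKC.
have -> : x - (n2%:R + 2 * k%:R + 2) = b by rewrite /b; ring.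
have shift c s0 : \prod_(y <- s0) (x - (y + c)) = \prod_(y <- s0) (x - c - y).
  by apply: eq_bigr => y _; ring.
rewrite !shift.
have bn : b^-1 ^+ n * b ^+ n = 1 by rewrite -exprMn mulVf // expr1n.
do 4!move: (\prod_(y <- _) _) => ?.
move: (b^-1 ^+ n) (b ^+ n) (b ^+ (m - n)) bn => u v w uv.
by rewrite /=; ring: uv.
Qed.

(** The quartic divides a product of linear factors and is monic of size 5, so it is itself a
    product of four of them. *)
Lemma qdjoin_spectrum : exists2 r : 4.-tuple R,
  dj_quartic n%:R m%:R n1%:R n2%:R k%:R = \prod_(x <- r) ('X - x%:P)
  & perm_eq (lap_spectrum R (qdjoin G G1 G2)) (dj_eigs ++ r).
Proof.
have Q_dvd : dj_quartic n%:R m%:R n1%:R n2%:R k%:R %|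
    \prod_(x <- lap_spectrum R (qdjoin G G1 G2)) ('X - x%:P).
  by rewrite -char_poly_laplacian qdjoin_char_poly dvdp_mulIr.
have [r Dr] := dvdp_prod_XsubC_split (dj_quartic_monic _ _ _ _ _) Q_dvd.
rewrite size_dj_quartic => -[/esym/eqP sz_r].
exists (Tuple sz_r) => //.
rewrite /lap_spectrum qdjoin_char_poly Dr -big_cat.
exact: perm_roots_mult.
Qed.
End Main.

Theorem theorem6 (R : rcfType) (G G1 G2 : sgraph) (k n m n1 n2 : nat)
    (G_connected : connected_graph G) (G_regular : regular G k)
    (card_G : #|G| = n) (card_edges : #|edges G| = m) (le_n_m : (n <= m)%N)
    (card_G1 : #|G1| = n1) (card_G2 : #|G2| = n2)
    (n1_ge1 : (1 <= n1)%N) (n2_ge1 : (1 <= n2)%N) :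
  exists r : 4.-tuple R,
    'X * ('X^3
          - (m%:R + n%:R + n1%:R + k%:R + n2%:R + 2)%:P * 'X^2
          + (2 * m%:R + (n1%:R + k%:R + n%:R) * (m%:R + n2%:R + 2)
             + n%:R * k%:R - 2 * k%:R)%:P * 'X
          + (2 * (n%:R + m%:R) * k%:R - 2 * (n1%:R + k%:R + n%:R) * m%:R
             - n%:R * k%:R * (m%:R + n2%:R + 2))%:P)
      = \prod_(x <- r) ('X - x%:P)
    /\ perm_eq (lap_spectrum R (qdjoin G G1 G2))
         ([seq lap_eig R G1 i + n%:R | i <- index_iota 2 n1.+1]
          ++ [seq lap_eig R G2 i + m%:R | i <- index_iota 2 n2.+1]
          ++ [seq (n1%:R + k%:R + n2%:R + 2 + lap_eig R G i
                   + Num.sqrt ((n1%:R + k%:R - n2%:R - 2 - lap_eig R G i) ^+ 2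
                               + 4 * (2 * k%:R - lap_eig R G i))) / 2
             | i <- index_iota 2 n.+1]
          ++ [seq (n1%:R + k%:R + n2%:R + 2 + lap_eig R G i
                   - Num.sqrt ((n1%:R + k%:R - n2%:R - 2 - lap_eig R G i) ^+ 2
                               + 4 * (2 * k%:R - lap_eig R G i))) / 2
             | i <- index_iota 2 n.+1]
          ++ nseq (m - n) (n2%:R + 2 * k%:R + 2)
          ++ r).
Proof.
have {card_edges} card_E : #|edge_type G| = m.
  by rewrite card_sig -card_edges; apply: eq_card => e.
have [G_gt0 _] := G_connected; subst n m n1 n2.
have [r Dr r_perm] := qdjoin_spectrum R G_regular le_n_m G_gt0 n1_ge1 n2_ge1.
exists r; split; first exact: Dr.
by move: r_perm; rewrite /dj_eigs -!map_comp -!catA.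
Qed.
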